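(* Let $n\ge 1$ and $1\le k\le \lfloor n/2\rfloor$. Then for every $1\le m\le n-1$, $$p_{n,m,k}+p_{n,m,n-k}=p_{n,m,k}+p_{n,n-m,k}=\frac{2(n+2)}{n(n-1)}\binom{n}{k-1}\binom{n}{k+1}.$$
   Context: A Dyck path of semilength $n\ge 0$ is a lattice path in $\mathbb{Z}\times\mathbb{Z}$ from $(0,0)$ to $(2n,0)$ using up steps $U=(1,1)$ and down steps $D=(1,-1)$; it is allowed to go below the $x$-axis. Write it as a word $P_1P_2\cdots P_{2n}$ over $\{U,D\}$. An up step is under the $x$-axis if it goes from height $-h$ to height $-h+1$ for some $h\ge 1$. A Dyck path is $(n,m)$-flawed if it has semilength $n$ and exactly $m$ up steps under the $x$-axis. A peak is a position $i$ with $P_iP_{i+1}=UD$. Let $p_{n,m,k}$ be the number of $(n,m)$-flawed paths with exactly $k$ peaks. *)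

(* Defs.v *)
From HB Require Import structures.
From mathcomp Require Import all_boot all_order all_algebra.
Set Implicit Arguments.
Unset Strict Implicit.
Unset Printing Implicit Defensive.
Import Order.TTheory GRing.Theory Num.Theory.

(* A lattice path is the word of its steps, starting at (0,0); words are      *)
(* indexed from 0, so P_{i+1} is [nth D w i].                                 *)
Notation step := bool (only parsing).
Notation U := true (only parsing).
Notation D := false (only parsing).

Definition step_height (s : step) : int := if s == U then 1%R else (- 1)%R.

Definition height (w : seq step) (i : nat) : int :=
  (\sum_(s <- take i w) step_height s)%R.

(* Paths may go below the x-axis. *)
Definition is_dyck (n : nat) (w : seq step) : bool :=
  (size w == 2 * n) && (height w (2 * n) == 0%R).

(* An up step raises the height by one, so it goes from height -h to -h+1     *)
(* for some h >= 1 exactly when its starting height is negative.              *)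
Definition up_under_axis (w : seq step) (i : nat) : bool :=
  [&& i < size w, nth D w i == U & (height w i < 0)%R].

Definition flaws (w : seq step) : nat :=
  count (up_under_axis w) (iota 0 (size w)).

Definition is_flawed (n m : nat) (w : seq step) : bool :=
  is_dyck n w && (flaws w == m).

Definition is_peak (w : seq step) (i : nat) : bool :=
  [&& i.+1 < size w, nth D w i == U & nth D w i.+1 == D].

Definition peaks (w : seq step) : nat :=
  count (is_peak w) (iota 0 (size w)).

Definition num_flawed (n m k : nat) : nat :=
  #|[set w : (2 * n).-tuple step | is_flawed n m w && (peaks w == k)]|.

(* Main.v *)
Require Import Defs.
From HB Require Import structures.
From mathcomp Require Import all_boot all_order all_algebra.
From mathcomp Require Import ring zify.
Set Implicit Arguments.
Unset Strict Implicit.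
Unset Printing Implicit Defensive.
Import Order.TTheory GRing.Theory Num.Theory.

(* Let E (resp. G) be the generating series of the paths staying above (resp. *)
(* below) the x-axis, x marking semilength and y peaks, and let W(x, z) be    *)
(* that of all paths, with z marking the up steps under the axis and x the    *)
(* other ones. Then                                                           *)
(*   (x - z) W(x, z) = x E(x) - z G(z) + (1 - y) x z E(x) G(z),               *)
(* that is, q(i, j+1) - q(i+1, j) = (1 - y) E_i G_j for the coefficients of   *)
(* W. Since E_n = y G_n for n > 0, the sum q(i, j) + q(j, i) depends only on  *)
(* n = i + j as long as i, j > 0, and equals (1 + y) G_n - (1 - y)^2 G_(n-1), *)
(* where G_n is a Narayana polynomial. The symmetry k <-> n - k follows from  *)
(* the same recurrence, as reversing coefficients exchanges E_n and G_n.      *)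
(* The formula for (x - z) W is not obtained from a path decomposition: the   *)
(* walks from an arbitrary height with a given last step satisfy a linear     *)
(* recurrence on their length, and an explicit solution multiplied by x - z   *)
(* is checked against it.                                                     *)

(** In code terms q(i, j) is [path_gf i j]. [walk_gf_sub] transfers the formula for (x - z) W from
    the explicit solution [walk_diff] to the walks, and [path_gf_exchange] reads it off at height 0.
    Exchanging one flaw in q(i, j) and in q(j, i) produces corrections that cancel because E_n = y
    G_n, whence [path_gf_sym_sum]. The first equality of the theorem comes from [rev_path_gf], the
    second from [narayana_sum]. *)

Fixpoint flaws_from (h : int) (w : seq step) : nat :=
  if w is s :: w' then
    (s && (h < 0)%R) + flaws_from (h + step_height s)%R w'
  else 0.

Fixpoint peaks_from (l : step) (w : seq step) : nat :=
  if w is s :: w' then (l && ~~ s) + peaks_from s w' else 0.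

Definition end_height (h : int) (w : seq step) : int :=
  (h + \sum_(s <- w) step_height s)%R.

Lemma flaws_flaws_from w : flaws w = flaws_from 0 w.
Proof.
suff gen h v : count (fun i => [&& i < size v, nth D v i == U
      & (h + height v i < 0)%R]) (iota 0 (size v)) = flaws_from h v.
  by rewrite -gen; apply: eq_count => i; rewrite /up_under_axis add0r.
elim: v h => [|s v IH] h //=.
rewrite (iotaDl 1 0) count_map /height take0 big_nil addr0 eqb_id /=.
congr (_ + _); rewrite -IH; apply: eq_count => i /=.
by rewrite /height big_cons addrA add1n ltnS.
Qed.

Lemma peaks_peaks_from w : peaks w = peaks_from D w.
Proof.
(* The extra term is the peak at the junction of [l] and [v]; the default [U] gives none when [v] is
   empty. *)
suff gen l v : (l && (head U v == D)) + count (is_peak v) (iota 0 (size v))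
    = peaks_from l v by rewrite -gen.
elim: v l => [|s v IH] l //=; first by rewrite andbF.
rewrite (iotaDl 1 0) count_map eqbF_neg; congr (_ + _).
rewrite -IH; congr (_ + _).
by rewrite /is_peak /= eqb_id; case: v {IH} => [|[] v]; rewrite /= ?andbF.
Qed.

(** * Peak polynomials of walks to the axis *)

Section GeneratingFunctions.
Local Open Scope ring_scope.

(** The previous step [l] is kept because a down step closes a peak exactly after an up step. The
    number [j] of flaws still to come is an integer, so that using too many yields 0. *)
Fixpoint walk_gf (L : nat) (h : int) (l : step) (j : int) : {poly int} :=
  if L is L'.+1 then
    walk_gf L' (h + 1) U (j - (h < 0)%R%:R)
    + 'X ^+ l * walk_gf L' (h - 1) D j
  else ((h == 0%R) && (j == 0%R))%:R.

Lemma sum_tuple_cons (L : nat) (f : seq step -> {poly int}) :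
  \sum_(w : L.+1.-tuple step) f w =
  \sum_(w : L.-tuple step) f (U :: w) + \sum_(w : L.-tuple step) f (D :: w).
Proof.
rewrite (reindex (fun p : step * L.-tuple step => cons_tuple p.1 p.2)) /=; last first.
  exists (fun w : L.+1.-tuple step => (thead w, [tuple of behead w])).
    by case=> s w _; congr pair; apply: val_inj.
  by move=> w _; case/tupleP: w => s w; apply: val_inj.
rewrite -(pair_bigA _ (fun s (w : L.-tuple step) => f (s :: w))) /=.
by rewrite big_bool.
Qed.

Lemma walk_gfE L h l j :
  walk_gf L h l j = \sum_(w : L.-tuple step)
    if (end_height h w == 0) && ((flaws_from h w)%:Z == j)
    then 'X^(peaks_from l w) else 0.
Proof.
elim: L h l j => [|L IH] h l j.
  rewrite (big_pred1 [tuple]) => [|w]; last by apply/esym/eqP/tuple0.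
  by rewrite /end_height big_nil addr0 /= [0%Z == j]eq_sym; case: ifP.
rewrite (sum_tuple_cons _ (fun w => if (end_height h w == 0) &&
  ((flaws_from h w)%:Z == j) then 'X^(peaks_from l w) else 0)) /= !IH.
congr (_ + _).
  apply: eq_bigr => w _; rewrite /end_height big_cons addrA andbF add0n.
  congr (if _ && _ then _ else _).
  by rewrite -[step_height U]/(1 : int); case: (h < 0)%R; lia.
rewrite mulr_sumr; apply: eq_bigr => w _.
rewrite /end_height big_cons addrA add0n andbT exprD.
by case: ifP; rewrite ?mulr0.
Qed.

End GeneratingFunctions.

Lemma num_flawed_gf n m k :
  ((num_flawed n m k)%:Z = (walk_gf (2 * n) 0 D m%:Z)`_k)%R.
Proof.
rewrite walk_gfE coef_sum /num_flawed -sum1_card.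
rewrite big_mkcond /= -natz natr_sum; apply: eq_bigr => w _.
rewrite inE /is_flawed /is_dyck size_tuple eqxx /= /height take_oversize ?size_tuple //.
rewrite /end_height add0r flaws_flaws_from peaks_peaks_from eqz_nat.
case: (_ && (flaws_from 0 w == m)); rewrite /= ?coef0 ?coefXn //.
by rewrite eq_sym; case: (k == _).
Qed.

(** * One-sided series and an explicit solution of the walk recurrence *)

Section WalkDifferences.
Local Open Scope ring_scope.

(* With E, G the Dyck path series of the header, [Ecoef h n k] and            *)
(* [Fcoef h n k] are the coefficients of x^n y^k in E^h and G E^h; the        *)
(* determinant shapes are those of a reflection argument.                     *)
Definition Fcoef (h n k : nat) : int :=
  'C((h + n).-1, k)%:R * 'C(n, k)%:R
  - (if k is k'.+1 then 'C((h + n).-1, k')%:R else 0) * 'C(n, k.+1)%:R.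

Definition Ecoef (h n k : nat) : int :=
  if n is n'.+1 then
    if k is k'.+1 then
      'C(h + n', k)%:R * 'C(n', k')%:R - 'C(h + n', k')%:R * 'C(n', k)%:R
    else 0
  else (k == 0%N)%:R.

Definition Fpoly (h n : nat) : {poly int} := \poly_(k < n.+1) Fcoef h n k.
Definition Epoly (h n : nat) : {poly int} := \poly_(k < n.+1) Ecoef h n k.

Lemma coef_Fpoly h n k : (Fpoly h n)`_k = Fcoef h n k.
Proof.
rewrite coef_poly; case: ltnP => // lt_nk; rewrite /Fcoef.
by rewrite !(@bin_small n) ?mulr0 ?subrr // ltnW.
Qed.

Lemma coef_Epoly h n k : (Epoly h n)`_k = Ecoef h n k.
Proof.
rewrite coef_poly; case: ltnP => // lt_nk; rewrite /Ecoef.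
case: n k lt_nk => [|n] [|k] // lt_nk.
by rewrite !(@bin_small n) ?mulr0 ?subrr // ltnW.
Qed.

Lemma Epoly_h0 h : Epoly h 0 = 1.
Proof. by apply/polyP => k; rewrite coef_Epoly coef1. Qed.

Lemma Fpoly_h0 h : Fpoly h 0 = 1.
Proof.
apply/polyP => k; rewrite coef_Fpoly coef1 /Fcoef bin0n mulr0 subr0.
by case: k => [|k]; rewrite ?mulr0 // bin0 mulr1.
Qed.

Lemma Epoly0S n : Epoly 0 n.+1 = 0.
Proof.
by apply/polyP => -[|k]; rewrite coef_Epoly coef0 //= add0n mulrC subrr.
Qed.

(** This is E = 1 + x y G E times E^h; on coefficients it is Pascal's rule. *)
Lemma EpolyS h n : Epoly h.+1 n.+1 = Epoly h n.+1 + 'X * Fpoly h.+1 n.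
Proof.
apply/polyP => k; rewrite coefD coefXM !coef_Epoly.
case: k => [|k] /=; first by rewrite addr0.
rewrite coef_Fpoly /Fcoef addSn /= !binS !natrD.
by case: k => [|k]; rewrite ?bin0 ?binS ?natrD; ring.
Qed.

(** This is G = 1 + x G E times E^h. *)
Lemma FpolyS h n : Fpoly h n.+1 = Epoly h n.+1 + Fpoly h.+1 n.
Proof.
apply/polyP => k; rewrite coefD coef_Epoly !coef_Fpoly /Fcoef addSn addnS /=.
by case: k => [|k]; rewrite ?bin0 ?bin1 ?binS ?natrD; ring.
Qed.

Lemma XFpoly h n : 'X * Fpoly h n = Epoly h.+1 n - (1 - 'X) * Epoly h n.
Proof.
case: n => [|n]; first by rewrite Fpoly_h0 !Epoly_h0; ring.
by rewrite FpolyS EpolyS; ring.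
Qed.

(** Extension by 0 to negative indices lets multiplication by x be an index shift without boundary
    cases. *)
Definition Eser (h : nat) (i : int) := if i is Posz n then Epoly h n else 0.
Definition Fser (h : nat) (i : int) := if i is Posz n then Fpoly h n else 0.

Lemma Eser_lt0 h i : i < 0 -> Eser h i = 0. Proof. by case: i. Qed.
Lemma Fser_lt0 h i : i < 0 -> Fser h i = 0. Proof. by case: i. Qed.

Lemma Eser0 i : Eser 0 i = (i == 0)%:R.
Proof. by case: i => [[|n]|n] //=; rewrite ?Epoly0S ?Epoly_h0. Qed.

Lemma EserS h i : Eser h.+1 i = Eser h i + 'X * Fser h.+1 (i - 1).
Proof.
case: i => [[|n]|n]; first by rewrite /= !Epoly_h0 mulr0 addr0.
  have -> : Posz n.+1 - 1 = n by lia.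
  by rewrite /= EpolyS.
by rewrite (@Fser_lt0 _ (Negz n - 1)) ?mulr0 ?addr0 //; lia.
Qed.

Lemma FserS h i : Fser h i = Eser h i + Fser h.+1 (i - 1).
Proof.
case: i => [[|n]|n]; first by rewrite /= Epoly_h0 Fpoly_h0 addr0.
  have -> : Posz n.+1 - 1 = n by lia.
  by rewrite /= FpolyS.
by rewrite (@Fser_lt0 _ (Negz n - 1)) ?addr0 //; lia.
Qed.

Lemma XFser h i : 'X * Fser h i = Eser h.+1 i - (1 - 'X) * Eser h i.
Proof. by case: i => n /=; rewrite ?XFpoly //; ring. Qed.

(* [walk_diff h l i j] is the coefficient of x^i z^j in (x - z) W_{h,l},      *)
(* where W_{h,l} counts the walks from height h, preceded by a step l, to the *)
(* axis. First passages to height 0 give, for h > 0,                          *)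
(*   W_{h,D} = E(x)^h W_{0,D},  W_{h,U} = (E(x) - 1 + y) E(x)^(h-1) W_{0,D},  *)
(*   W_{-h,U} = (z E(z))^h W_{0,U},                                           *)
(*   W_{-h,D} = z G(z) (z E(z))^(h-1) W_{0,U},                                *)
(* with the base cases                                                        *)
(*   (x - z) W_{0,D} = x E(x) - z G(z) + (1 - y) x z E(x) G(z),               *)
(*   (x - z) W_{0,U} = x E(x) - z E(z).                                       *)
Definition diff_down (h : nat) (i j : int) : {poly int} :=
  Eser h.+1 (i - 1) * Eser 0 j - Eser h i * Fser 0 (j - 1)
  + (1 - 'X) * Eser h.+1 (i - 1) * Fser 0 (j - 1).

Definition walk_diff (h : int) (l : bool) (i j : int) : {poly int} :=
  match h, l with
  | Posz 0, true => Eser 1 (i - 1) * Eser 0 j - Eser 0 i * Eser 1 (j - 1)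
  | Posz h'.+1, true => diff_down h'.+1 i j - (1 - 'X) * diff_down h' i j
  | Posz h', false => diff_down h' i j
  | Negz a, true =>
      Eser 1 (i - 1) * Eser a.+1 (j - a.+1%:Z)
      - Eser 0 i * Eser a.+2 (j - a.+1%:Z - 1)
  | Negz a, false =>
      Eser 1 (i - 1) * Fser a (j - a.+1%:Z)
      - Eser 0 i * Fser a.+1 (j - a.+1%:Z - 1)
  end.

(** Eliminating G leaves E = 1 + x E^2 - (1 - y) x E, here times E^h. *)
Lemma EserSS h i :
  Eser h.+1 i = Eser h i + Eser h.+2 (i - 1) - (1 - 'X) * Eser h.+1 (i - 1).
Proof. by rewrite (EserS h i) XFser; ring. Qed.

Lemma diff_downS h i j :
  diff_down h.+1 i j = diff_down h.+2 (i - 1) j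
    - (1 - 'X) * diff_down h.+1 (i - 1) j + diff_down h i j.
Proof.
by rewrite /diff_down (EserSS h i) (EserSS h.+1 (i - 1)); ring.
Qed.

Lemma walk_diff_pos h l i j :
  walk_diff (Posz h.+1) l i j =
  walk_diff (Posz h.+2) true (i - 1) j + 'X ^+ l * walk_diff (Posz h) false i j.
Proof.
have -> : walk_diff (Posz h) false i j = diff_down h i j by case: h.
case: l => /=; first (rewrite {1}(diff_downS h i j) expr1; ring).
by rewrite expr0 mul1r -diff_downS.
Qed.

(** The last term is the coefficient of x - z, the contribution of the empty walk. *)
Lemma walk_diff_zero l i j :
  walk_diff 0 l i j =
  walk_diff 1 true (i - 1) j + 'X ^+ l * walk_diff (-1) false i j
    + (Eser 0 (i - 1) * Eser 0 j - Eser 0 i * Eser 0 (j - 1)).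
Proof.
(* A preceding up step only affects walks that start downwards, each gaining one peak. *)
have -> : walk_diff 0 l i j =
    diff_down 0 i j - (1 - 'X ^+ l) * walk_diff (-1) false i j.
  case: l => /=; last by rewrite expr0; ring.
  by rewrite /diff_down expr1 (FserS 0) (EserS 0 (j - 1)); ring.
rewrite /walk_diff /= /diff_down (FserS 0 (j - 1)).
have -> : Eser 2 (i - 1 - 1) =
    Eser 1 (i - 1) - Eser 0 (i - 1) + (1 - 'X) * Eser 1 (i - 1 - 1).
  by rewrite (EserSS 0 (i - 1)); ring.
ring.
Qed.

(** For [l = D] this rests on G = 1 + z G E, for [l = U] on E = 1 + y z G E. *)
Lemma walk_diff_neg a l i j :
  walk_diff (Negz a) l i j =
  walk_diff (Negz a + 1) true i (j - 1) + 'X ^+ l * walk_diff (Negz a - 1) false i j.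
Proof.
have -> : Negz a - 1 = Negz a.+1 by lia.
have -> : walk_diff (Negz a + 1) true i (j - 1) =
    Eser 1 (i - 1) * Eser a (j - a.+1%:Z) - Eser 0 i * Eser a.+1 (j - a.+1%:Z - 1).
  case: a => [|a]; first by [].
  have -> : Negz a.+1 + 1 = Negz a by lia.
  by rewrite /=; have -> : j - 1 - a.+1%:Z = j - a.+2%:Z by lia.
rewrite /=; have -> : j - a.+2%:Z = j - a.+1%:Z - 1 by lia.
case: l => /=.
  by rewrite expr1 (EserS a) (EserS a.+1); ring.
by rewrite expr0 (FserS a) (FserS a.+1); ring.
Qed.

Lemma walk_diff_step h l i j : h <> 0 \/ i + j <> 1 ->
  walk_diff h l i j =
  walk_diff (h + 1) true (i - (0 <= h)%R%:R) (j - (h < 0)%R%:R)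
    + 'X ^+ l * walk_diff (h - 1) false i j.
Proof.
case: h => [[|h]|a] hij.
- rewrite walk_diff_zero /= subr0 !Eser0.
  suff -> : (i - 1 == 0)%:R * (j == 0)%:R =
      (i == 0)%:R * (j - 1 == 0)%:R :> {poly int}.
    by rewrite subrr addr0.
  rewrite -!natrM !mulnb; congr (_%:R); congr nat_of_bool; lia.
- rewrite walk_diff_pos subr0; congr (_ + _ * _); congr walk_diff; lia.
- by rewrite walk_diff_neg subr0.
Qed.

(** Every term of the series carries a factor x or z. *)
Lemma diff_down_eq0 h i j : i + j <= 0 -> diff_down h i j = 0.
Proof.
move=> ij; rewrite /diff_down; case: (ltP j 0) => [j0|j0].
  by rewrite (Eser_lt0 _ j0) (@Fser_lt0 _ (j - 1)); [ring | lia].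
rewrite (@Eser_lt0 _ (i - 1)); last lia.
case: (ltP i 0) => [i0|i0]; first by rewrite (Eser_lt0 _ i0); ring.
by rewrite (@Fser_lt0 _ (j - 1)); [ring | lia].
Qed.

Lemma walk_diff_base h l i j : h + 2 * i + 2 * j = 2 ->
  walk_diff h l i j =
  ((h == 0) && (j == 0))%R%:R - ((h == 0) && (j - 1 == 0))%R%:R.
Proof.
case: h => [[|h]|a] hij.
- case: (j =P 0) => [j0|j0].
    have i1 : i = 1 by lia.
    by case: l; rewrite i1 j0 /= /diff_down /= !Epoly_h0 !Epoly0S; ring.
  case: (j =P 1) => [j1|j1].
    have i0 : i = 0 by lia.
    by case: l; rewrite i0 j1 /= /diff_down /= !Epoly_h0 ?Fpoly_h0; ring.
  have -> : (j - 1 == 0) = false by apply/eqP; lia.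
  rewrite subr0; case: (ltP j 0) => [lj0|lj0].
    have lj1 : j - 1 < 0 by lia.
    by case: l;
      rewrite /= /diff_down !(Eser_lt0 _ lj0) !(Eser_lt0 _ lj1, Fser_lt0 _ lj1); ring.
  have li0 : i < 0 by lia.
  have li1 : i - 1 < 0 by lia.
  by case: l; rewrite /= /diff_down !(Eser_lt0 _ li0, Eser_lt0 _ li1); ring.
- by case: l; rewrite /= !diff_down_eq0 ?subrr ?mulr0 ?subrr //; lia.
- rewrite /= subr0; case: (ltP 0 i) => [i0|i0].
    have j0 : j - a.+1%:Z < 0 by lia.
    have j1 : j - a.+1%:Z - 1 < 0 by lia.
    by case: l;
      rewrite ?(Eser_lt0 _ j0, Eser_lt0 _ j1, Fser_lt0 _ j0, Fser_lt0 _ j1); ring.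
  have i1 : i - 1 < 0 by lia.
  case: (ltP i 0) => [li0|li0].
    by case: l; rewrite (Eser_lt0 _ i1) (Eser_lt0 _ li0); ring.
  have j1 : j - a.+1%:Z - 1 < 0 by lia.
  by case: l; rewrite ?(Eser_lt0 _ i1, Eser_lt0 _ j1, Fser_lt0 _ j1); ring.
Qed.
End WalkDifferences.

(** * Exchanging a flaw for an up step above the axis *)

Section FlawExchange.
Local Open Scope ring_scope.

(** A walk from [h] to the axis with i - 1 unflawed and j flawed up steps has length h + 2 (i - 1) +
    2 j. The case excluded in [walk_diff_step] would thus have length 0. *)
Lemma walk_gf_sub L h l i j : h + 2 * i + 2 * j = L%:Z + 2 ->
  walk_gf L h l j - walk_gf L h l (j - 1) = walk_diff h l i j.
Proof.
elim: L h l i j => [|L IH] h l i j hij.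
  by rewrite (@walk_diff_base h l i j) //; lia.
rewrite walk_diff_step; last lia.
rewrite /= -(IH (h - 1)); last lia.
rewrite -(IH (h + 1)) 1?[j - 1 - _]addrAC; last by case: ltP; lia.
ring.
Qed.

Lemma walk_gf_neg_flaws L h l j : j < 0 -> walk_gf L h l j = 0.
Proof.
move=> j0; rewrite walk_gfE big1 // => w _.
by case: ifP => // /andP[_ /eqP jw]; move: j0; rewrite -jw.
Qed.

(** With j flawed up steps, reaching the axis takes at least h + j down steps. *)
Lemma walk_gf_short L h l j : L%:Z < h + 2 * j -> walk_gf L h l j = 0.
Proof.
elim: L h l j => [|L IH] h l j hL /=.
  by case: eqP => [h0|]; case: eqP => [j0|] //; move: hL; rewrite h0 j0.
by rewrite !IH ?mulr0 ?addr0 //; [lia | case: ltP; lia].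
Qed.

Definition path_gf (i j : nat) : {poly int} := walk_gf (2 * (i + j)) 0 D j.

Lemma path_gf_n0 n : path_gf n 0 = Epoly 1 n.
Proof.
rewrite /path_gf -[LHS]subr0 -(@walk_gf_neg_flaws (2 * (n + 0)) 0 D (0 - 1)) //.
rewrite (@walk_gf_sub _ _ _ n.+1); last lia.
rewrite /= /diff_down; have -> : n.+1%:Z - 1 = n by lia.
by rewrite /= Epoly_h0; ring.
Qed.

(** The difference relation is taken at n + 1 flaws, too many for length 2 n, so only the subtracted
    term survives. *)
Lemma path_gf_0n n : path_gf 0 n = Fpoly 0 n.
Proof.
have e : n.+1%:Z - 1 = n by lia.
have := @walk_gf_sub (2 * (0 + n)) 0 D 0 n.+1.
rewrite (@walk_gf_short _ _ _ n.+1) ?sub0r ?e /walk_diff /diff_down; last lia.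
move=> /(_ ltac:(lia)) /(congr1 -%R); rewrite opprK /path_gf => ->.
rewrite (@Eser_lt0 _ (0 - 1)) // e /= !Epoly_h0; ring.
Qed.

Lemma path_gf_exchange i j :
  path_gf i j.+1 = path_gf i.+1 j + (1 - 'X) * Epoly 1 i * Fpoly 0 j.
Proof.
apply/eqP; rewrite addrC -subr_eq; apply/eqP; rewrite /path_gf addSnnS.
have -> : walk_gf (2 * (i + j.+1)) 0 false j =
  walk_gf (2 * (i + j.+1)) 0 false (j.+1%:Z - 1) by congr walk_gf; lia.
rewrite (@walk_gf_sub _ _ _ i.+1); last lia.
rewrite /= /diff_down; have -> : i.+1%:Z - 1 = i by lia.
have -> : j.+1%:Z - 1 = j by lia.
by rewrite /= !Epoly0S; ring.
Qed.

(** Reflection in the axis turns peaks into valleys, and a nonempty path above the axis has one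
    valley fewer than peaks. *)
Lemma EpolyXF n : Epoly 1 n.+1 = 'X * Fpoly 0 n.+1.
Proof. by rewrite EpolyS FpolyS Epoly0S !add0r. Qed.

Lemma path_gf_sym_sum i j :
  path_gf i.+1 j.+1 + path_gf j.+1 i.+1 =
  (1 + 'X) * Fpoly 0 (i + j).+2 - (1 - 'X) ^+ 2 * Fpoly 0 (i + j).+1.
Proof.
elim: j i => [|j IH] i.
  have := path_gf_exchange 0 i.+1.
  rewrite path_gf_0n => /eqP; rewrite -subr_eq => /eqP <-.
  rewrite path_gf_exchange path_gf_n0 Epoly_h0 Fpoly_h0 !EpolyXF addn0.
  ring.
have := path_gf_exchange j.+1 i.+1.
move=> /eqP; rewrite -subr_eq => /eqP <-.
rewrite path_gf_exchange addnS -addSn -IH !EpolyXF; ring.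
Qed.

(** * Reversal of the peak polynomials *)

(** The formal degree [n] is fixed independently of [p], which makes reversal linear. *)
Definition rev_poly (n : nat) (p : {poly int}) : {poly int} :=
  \sum_(k < n.+1) p`_k *: 'X^(n - k).

Lemma coef_rev_poly n p k : (k <= n)%N -> (rev_poly n p)`_k = p`_(n - k).
Proof.
move=> kn; rewrite /rev_poly coef_sum.
have lt : (n - k < n.+1)%N by lia.
rewrite (bigD1 (Ordinal lt)) //= coefZ coefXn subKn // eqxx mulr1 big1 ?addr0 //.
move=> i /eqP neq; rewrite coefZ coefXn; case: eqP => [ki|]; last by rewrite mulr0.
by case: neq; apply: val_inj => /=; have := ltn_ord i; lia.
Qed.

Fact rev_poly_linear n : linear (rev_poly n).
Proof.
move=> c p q; rewrite /rev_poly scaler_sumr -big_split; apply: eq_bigr => k _ /=.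
by rewrite coefD coefZ scalerDl scalerA.
Qed.
HB.instance Definition _ n :=
  GRing.isLinear.Build int {poly int} {poly int} _ (rev_poly n) (rev_poly_linear n).

Lemma rev_polyXn n a : (a <= n)%N -> rev_poly n 'X^a = 'X^(n - a).
Proof.
move=> an; rewrite /rev_poly (bigD1 (Ordinal (an : (a < n.+1)%N))) //=.
rewrite coefXn eqxx scale1r big1 ?addr0 // => i /eqP neq.
rewrite coefXn; case: eqP => [ia|]; last by rewrite scale0r.
by case: neq; apply: val_inj.
Qed.

Lemma rev_polyM m n (p q : {poly int}) :
  (size p <= m.+1)%N -> (size q <= n.+1)%N ->
  rev_poly (m + n) (p * q) = rev_poly m p * rev_poly n q.
Proof.
move=> sp sq.
have pE : p = \sum_(i < m.+1) p`_i *: 'X^i by rewrite -poly_def; apply/esym/take_poly_id.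
have qE : q = \sum_(i < n.+1) q`_i *: 'X^i by rewrite -poly_def; apply/esym/take_poly_id.
rewrite {1}pE {1}qE mulr_suml linear_sum /= [in RHS]/rev_poly mulr_suml.
apply: eq_bigr => i _; rewrite !mulr_sumr linear_sum; apply: eq_bigr => j _ /=.
rewrite -!scalerAl -!scalerAr !linearZ /= -!exprD rev_polyXn.
  rewrite scalerA mulrC -scalerA; congr (_ *: (_ *: 'X^_)).
  by have := ltn_ord i; have := ltn_ord j; lia.
by have := ltn_ord i; have := ltn_ord j; lia.
Qed.

Lemma rev_poly1BX : rev_poly 1 (1 - 'X) = 'X - 1.
Proof.
by rewrite linearB; congr (_ - _); [exact: (@rev_polyXn 1 0) | exact: (@rev_polyXn 1 1)].
Qed.

Lemma Ecoef_rev n k : (k <= n)%N -> Ecoef 1 n (n - k) = Fcoef 0 n k.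
Proof.
case: n => [|n]; first by case: k => // _; rewrite /Fcoef !bin0 mulr0; ring.
rewrite leq_eqVlt => /orP[/eqP ->|].
  by rewrite subnn /Fcoef /= binn (@bin_small n n.+1) // (@bin_small n.+1) //; ring.
rewrite ltnS => kn; rewrite subSn // /Ecoef /Fcoef add0n add1n /=.
have -> : 'C(n.+1, (n - k).+1) = 'C(n.+1, k) by rewrite -subSn // bin_sub // leqW.
have -> : 'C(n.+1, n - k) = 'C(n.+1, k.+1) by rewrite -subSS bin_sub.
rewrite bin_sub //; case: k kn => [|k] kn.
  by rewrite subn0 (@bin_small n n.+1) // bin0; ring.
by rewrite subnSK // bin_sub 1?ltnW //; ring.
Qed.

Lemma rev_Epoly n : rev_poly n (Epoly 1 n) = Fpoly 0 n.
Proof.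
apply/polyP => k; rewrite coef_Fpoly.
case: (leqP k n) => [kn|nk]; first by rewrite coef_rev_poly // coef_Epoly Ecoef_rev.
rewrite -coef_Fpoly (nth_default _ (leq_trans (size_poly _ _) nk)) coef_sum big1 // => i _.
by rewrite coefZ coefXn; case: eqP => [ki|]; [move: nk; rewrite ki; lia | rewrite mulr0].
Qed.

Lemma rev_Fpoly n : rev_poly n (Fpoly 0 n) = Epoly 1 n.
Proof.
rewrite -rev_Epoly; apply/polyP => k.
case: (leqP k n) => [kn|nk].
  by rewrite !coef_rev_poly ?leq_subr // subKn.
rewrite [RHS](nth_default _ (leq_trans (size_poly _ _) nk)) coef_sum big1 // => i _.
by rewrite coefZ coefXn; case: eqP => [ki|]; [move: nk; rewrite ki; lia | rewrite mulr0].
Qed.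

(** Reversal turns (1 - y) E_i G_j into -(1 - y) E_j G_i, so the exchange relation is mapped to
    itself with i and j swapped. *)
Lemma rev_path_gf i j : rev_poly (i + j) (path_gf i j) = path_gf j i.
Proof.
elim: j i => [|j IH] i; first by rewrite addn0 path_gf_n0 path_gf_0n rev_Epoly.
rewrite path_gf_exchange linearD /= -{1}addSnnS IH -mulrA.
have -> : (i + j.+1 = 1 + (i + j))%N by lia.
have sE : (size (Epoly 1 i) <= i.+1)%N by exact: size_poly.
have sF : (size (Fpoly 0 j) <= j.+1)%N by exact: size_poly.
rewrite rev_polyM; last first.
- by apply: leq_trans (size_polyMleq _ _) _; lia.
- by rewrite -opprB size_polyN size_XsubC.
rewrite rev_polyM // rev_poly1BX rev_Epoly rev_Fpoly path_gf_exchange; ring.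
Qed.

(** * Narayana numbers and the closed formula *)

Lemma Fcoef_narayana n k :
  n.+1%:R * Fcoef 0 n.+1 k = 'C(n.+1, k)%:R * 'C(n.+1, k.+1)%:R.
Proof.
have d : forall m, n.+1%:R * 'C(n, m)%:R = m.+1%:R * 'C(n.+1, m.+1)%:R :> int.
  by move=> m; rewrite -!natrM mul_bin_diag.
rewrite /Fcoef add0n /= mulrBr !mulrA d.
case: k => [|k]; first by rewrite mulr0 mul0r; ring.
by rewrite d -!natr1; ring.
Qed.

Lemma narayana_sum (s a : nat) (n := (a + s).+2) :
  (Fcoef 0 n a.+1)%:~R + (Fcoef 0 n a)%:~R - (Fcoef 0 n.-1 a.+1)%:~R
    + 2 * (Fcoef 0 n.-1 a)%:~R - (if a is b.+1 then Fcoef 0 n.-1 b else 0)%:~R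
  = (2 * (n%:R + 2)) / (n%:R * (n%:R - 1)) * 'C(n, a)%:R * 'C(n, a.+2)%:R :> rat.
Proof.
rewrite {}/n /=.
have nar m k : (Fcoef 0 m.+1 k)%:~R = 'C(m.+1, k)%:R * 'C(m.+1, k.+1)%:R / m.+1%:R :> rat.
  have /(congr1 (fun z : int => z%:~R : rat)) := Fcoef_narayana m k.
  rewrite !rmorphM /= !rmorph_nat => <-.
  by rewrite mulrAC mulfV ?mul1r // pnatr_eq0.
have binL : forall m k, (k <= m)%N ->
    'C(m, k.+1)%:R = (m%:R - k%:R) / k.+1%:R * 'C(m, k)%:R :> rat.
  move=> m k km; have := mul_bin_left m k => /(congr1 (fun z => z%:R : rat)).
  by rewrite !natrM natrB // => e; rewrite mulrAC -e mulrAC mulfV ?mul1r // pnatr_eq0.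
have down : forall m k, (k <= m.+1)%N ->
    'C(m, k)%:R = (m.+1%:R - k%:R) / m.+1%:R * 'C(m.+1, k)%:R :> rat.
  move=> m k km; have := mul_bin_down m.+1 k => /(congr1 (fun z => z%:R : rat)).
  by rewrite !natrM natrB // => e; rewrite mulrAC -e mulrAC mulfV ?mul1r // pnatr_eq0.
have n0 k : k.+1%:R != 0 :> rat by rewrite pnatr_eq0.
(* The factor [a%:R] absorbs the case [a = 0], so one formula serves both branches. *)
have -> : (if a is b.+1 then Fcoef 0 (a + s).+1 b else 0)%:~R =
    a%:R / (a + s).+2%:R * 'C((a + s).+2, a)%:R * 'C((a + s).+1, a)%:R / (a + s).+1%:R :> rat.
  case: a => [|b]; first by rewrite mulr0z !mul0r.
  rewrite nar; congr (_ * _ / _).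
  have := mul_bin_diag (b.+1 + s).+2 b => /(congr1 (fun z => z%:R : rat)).
  by rewrite !natrM => e; rewrite mulrAC -e mulrAC mulfV ?mul1r.
(* Every binomial becomes a rational multiple of C(n, a), leaving an identity of rational functions
   in [a] and [s]. *)
rewrite !nar !(@down (a + s).+1); try lia.
rewrite (@binL _ a.+1); last lia.
rewrite (@binL _ a); last lia.
have e2 : (a + s).+2%:R = a%:R + s%:R + 2 :> rat by rewrite -addn2 !natrD.
have e1 : (a + s).+1%:R = a%:R + s%:R + 1 :> rat by rewrite -addn1 !natrD.
have nz1 : a%:R + 1 != 0 :> rat by rewrite natr1.
have nz2 : a%:R + 2 != 0 :> rat by rewrite -natrD addn2.
have := n0 (a + s).+1; have := n0 (a + s)%N; rewrite e1 e2 => nz3 nz4.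
have -> : a.+1%:R = a%:R + 1 :> rat by rewrite natr1.
have -> : a.+2%:R = a%:R + 2 :> rat by rewrite -addn2 natrD.
field.
have -> : a%:R + s%:R + 2 - 1 = a%:R + s%:R + 1 :> rat by ring.
by rewrite nz1 nz2 nz3 nz4.
Qed.

Lemma coef_path_gf_sym_sum i j a :
  (path_gf i.+1 j.+1 + path_gf j.+1 i.+1)`_a.+1 =
  Fcoef 0 (i + j).+2 a.+1 + Fcoef 0 (i + j).+2 a - Fcoef 0 (i + j).+1 a.+1
    + 2 * Fcoef 0 (i + j).+1 a
    - (if a is b.+1 then Fcoef 0 (i + j).+1 b else 0).
Proof.
rewrite path_gf_sym_sum.
have -> : (1 + 'X) * Fpoly 0 (i + j).+2 - (1 - 'X) ^+ 2 * Fpoly 0 (i + j).+1 =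
  Fpoly 0 (i + j).+2 + 'X * Fpoly 0 (i + j).+2 - Fpoly 0 (i + j).+1
  + 'X * Fpoly 0 (i + j).+1 *+ 2 - 'X * ('X * Fpoly 0 (i + j).+1) :> {poly int} by ring.
rewrite !(coefD, coefN, coefMn, coefXM) /= !coef_Fpoly.
case: a => [|a] /=; rewrite ?coef_Fpoly; ring.
Qed.

Lemma num_flawed_path_gf i j k : (num_flawed (i + j) j k)%:Z = (path_gf i j)`_k.
Proof. exact: num_flawed_gf. Qed.

Lemma num_flawed_rev i j k : (k <= i + j)%N ->
  num_flawed (i + j) j (i + j - k) = num_flawed (i + j) i k.
Proof.
move=> kn; apply/eqP; rewrite -eqz_nat num_flawed_path_gf -coef_rev_poly // rev_path_gf.
by rewrite (addnC i) num_flawed_path_gf.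
Qed.

End FlawExchange.

Theorem theorem3p2 (n k m : nat) (hn : 1 <= n) (hk1 : 1 <= k)
    (hk2 : k <= n./2) (hm1 : 1 <= m) (hm2 : m <= n - 1) :
  num_flawed n m k + num_flawed n m (n - k)
    = num_flawed n m k + num_flawed n (n - m) k /\
  ((num_flawed n m k + num_flawed n (n - m) k)%:R
    = (2 * (n%:R + 2)) / (n%:R * (n%:R - 1))
        * 'C(n, k - 1)%:R * 'C(n, k + 1)%:R :> rat)%R.
Proof.
have [i ni] : {i | n = i.+1 + m} by exists (n - m).-1; lia.
case: m ni hm1 hm2 => // j ni _ _.
have kn : k <= i.+1 + j.+1 by lia.
have nj : n - j.+1 = i.+1 by lia.
rewrite nj ni num_flawed_rev //; split=> //.
case: k hk1 hk2 kn => // a _ hk2 kn.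
have [s es] : {s | i + j = a + s} by exists (i + j - a); lia.
have -> x y : ((x + y)%:R = (x%:Z + y%:Z)%:~R :> rat)%R by rewrite -PoszD.
rewrite num_flawed_path_gf (addnC i.+1) num_flawed_path_gf -coefD.
rewrite coef_path_gf_sym_sum addSn addnS (addnC j) es.
rewrite subn1 addn1 -(narayana_sum s a) !(rmorphD, rmorphN, rmorphM) //=.
Qed.
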